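(* For $i=1,\dots,n$ let $(\mathbb{Z},\sigma^{(i)})$ be the one-dimensional lattice with unit edge weights and a connection $\sigma^{(i)}:E(\mathbb{Z})\to O(d_i)$, and let $\hat\sigma=\sigma^{(1)}\otimes\cdots\otimes\sigma^{(n)}$ be the product connection on $\mathbb{Z}^n=\mathbb{Z}\square\cdots\square\mathbb{Z}$. Let $H_t^{\mathbb{Z}^n,\hat\sigma}=\exp(-t\mathcal{L}^{\mathbb{Z}^n,\hat\sigma})$ be the connection heat kernel of $(\mathbb{Z}^n,\hat\sigma)$. Then for all $(x_1,\dots,x_n),(a_1,\dots,a_n)\in\mathbb{Z}^n$, $$H_t^{\mathbb{Z}^n,\hat{\sigma}}\big((x_1,\dots,x_n),(x_1+a_1,\dots,x_n+a_n)\big)=\prod_{i=1}^{n}\left((-1)^{|a_i|} \sum_{k\ge 0}\frac{C_{2k}^{k+|a_i|}}{k!} \Big(-\frac{t}{2n}\Big)^k\right) \sigma^{(1)}_{P_{x_1\rightarrow x_1+a_1}}\otimes \cdots\otimes \sigma^{(n)}_{P_{x_n\rightarrow x_n+a_n}},$$ where $\sigma^{(i)}_{P_{x_i\to x_i+a_i}}$ is the signature of the unique path from $x_i$ to $x_i+a_i$ in $(\mathbb{Z},\sigma^{(i)})$.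
   Context: A connection assigns to each ordered pair of adjacent vertices $(u,v)$ a matrix $\sigma_{uv}\in O(d)$ with $\sigma_{vu}=\sigma_{uv}^{-1}$. The normalized connection Laplacian of a connection graph is $\mathcal{L}^{\sigma}=I-(D^{\sigma})^{-1/2}A^{\sigma}(D^{\sigma})^{-1/2}$ ($D^{\sigma}$ block diagonal with blocks $d(u)I_d$, $A^{\sigma}$ with block $w_{uv}\sigma_{uv}$ at adjacent $(u,v)$); on $\mathbb{Z}^n$ with unit weights, $(\mathcal{L}^{\hat\sigma}f)(u)=f(u)-\frac{1}{2n}\sum_{v\sim u}\hat\sigma_{uv}f(v)$. The connection heat kernel is $H_t=\exp(-t\mathcal{L}^{\sigma})$, and $H_t(x,y)$ denotes its $(x,y)$ matrix block. The Cartesian product $\mathbb{Z}^n$ has $x\sim y$ iff $x,y$ differ by $\pm1$ in exactly one coordinate; the product connection is $\hat\sigma_{(x_1,\dots,x_i,\dots,x_n)(x_1,\dots,y_i,\dots,x_n)}=I_{d_1}\otimes\cdots\otimes\sigma^{(i)}_{x_iy_i}\otimes\cdots\otimes I_{d_n}$ (Kronecker products). The signature of a path $P:x_0\sim x_1\sim\cdots\sim x_m$ is $\sigma_P=\sigma_{x_0x_1}\sigma_{x_1x_2}\cdots\sigma_{x_{m-1}x_m}$ (the identity for a path of length $0$). $C_m^j=\binom{m}{j}$, taken to be $0$ when $j>m$. *)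

(* Defs.v *)
From HB Require Import structures.
From mathcomp Require Import all_boot all_order all_algebra.
From mathcomp Require Import all_classical all_reals all_analysis.
From mathcomp Require Import mxtens zify ring lra.

Set Implicit Arguments.
Unset Strict Implicit.
Unset Printing Implicit Defensive.

Import Order.TTheory GRing.Theory Num.Theory.
Import numFieldNormedType.Exports.

Local Open Scope classical_set_scope.
Local Open Scope ring_scope.

(** * Connection graphs *)

Definition orthogonal_mx (R : realType) (d : nat) (A : 'M[R]_d) : Prop :=
  A *m A^T = 1%:M.

(* A connection is a total function; only its values at adjacent pairs are
   constrained, and only those are ever used. *)
Definition is_connection (R : realType) (d : nat) (V : Type) (adj : rel V)
    (sigma : V -> V -> 'M[R]_d) : Prop :=
  forall u v, adj u v ->
    orthogonal_mx (sigma u v) /\ sigma v u = invmx (sigma u v).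

Fixpoint signature (R : realType) (d : nat) (V : Type)
    (sigma : V -> V -> 'M[R]_d) (x : V) (p : seq V) : 'M[R]_d :=
  if p is y :: p' then sigma x y *m signature sigma y p' else 1%:M.

(* Weighted degree; the sum is finite on a locally finite graph. *)
Definition wdegree (R : realType) (V : choiceType) (adj : rel V)
    (w : V -> V -> R) (u : V) : R :=
  \sum_(v \in [set v | adj u v]) w u v.

(* I - D^(-1/2) A D^(-1/2), acting on vector-valued functions on the vertices
   of a locally finite graph. *)
Definition connection_laplacian (R : realType) (d : nat) (V : choiceType)
    (adj : rel V) (w : V -> V -> R) (sigma : V -> V -> 'M[R]_d)
    (f : V -> 'cV[R]_d) (u : V) : 'cV[R]_d :=
  f u - \sum_(v \in [set v | adj u v])
    ((Num.sqrt (wdegree adj w u))^-1 * w u v * (Num.sqrt (wdegree adj w v))^-1)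
      *: (sigma u v *m f v).

Definition delta_fun (R : realType) (d : nat) (V : choiceType) (y : V)
    (j : 'I_d) : V -> 'cV[R]_d :=
  fun z => if z == y then delta_mx j 0 else 0.

(* The (x, y) block of an operator T: its j-th column is the value at x of T
   applied to the function e_j supported at y. *)
Definition op_block (R : realType) (d : nat) (V : choiceType)
    (T : (V -> 'cV[R]_d) -> (V -> 'cV[R]_d)) (x y : V) : 'M[R]_d :=
  \matrix_(i, j) T (delta_fun R y j) x i 0.

(* Partial sums of the exponential series sum_k T^k / k!, applied to f and
   evaluated at x. *)
Definition op_exp_series (R : realType) (d : nat) (V : choiceType)
    (T : (V -> 'cV[R]_d) -> (V -> 'cV[R]_d)) (f : V -> 'cV[R]_d) (x : V) :
    nat -> 'cV[R]_d :=
  series (fun k => (k`!%:R)^-1 *: iter k T f x).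

Definition op_exp (R : realType) (d : nat) (V : choiceType)
    (T : (V -> 'cV[R]_d) -> (V -> 'cV[R]_d)) :
    (V -> 'cV[R]_d) -> (V -> 'cV[R]_d) :=
  fun f x => limn (op_exp_series T f x).

Definition heat_generator (R : realType) (d : nat) (V : choiceType)
    (adj : rel V) (w : V -> V -> R) (sigma : V -> V -> 'M[R]_d) (t : R) :
    (V -> 'cV[R]_d) -> (V -> 'cV[R]_d) :=
  fun f u => - t *: connection_laplacian adj w sigma f u.

Definition heat_kernel (R : realType) (d : nat) (V : choiceType)
    (adj : rel V) (w : V -> V -> R) (sigma : V -> V -> 'M[R]_d) (t : R)
    (x y : V) : 'M[R]_d :=
  op_block (op_exp (heat_generator adj w sigma t)) x y.

(** * Iterated Kronecker products *)

Fixpoint kron_dim (n : nat) : ('I_n -> nat) -> nat :=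
  if n is n'.+1 then
    fun d => (d ord0 * kron_dim (fun i => d (lift ord0 i)))%N
  else fun=> 1%N.

(* A_0 (x) (A_1 (x) ( ... (A_(n-1) (x) 1))), with 1 the 1 x 1 identity. *)
Fixpoint kron (R : realType) (n : nat) :
    forall d : 'I_n -> nat, (forall i, 'M[R]_(d i)) -> 'M[R]_(kron_dim d) :=
  match n with
  | 0 => fun _ _ => 1%:M
  | n'.+1 => fun d A => tensmx (A ord0) (kron (fun i => A (lift ord0 i)))
  end.

(** * The lattices Z and Z^n *)

Definition Z_adj : rel int := [rel x y | `|x - y| == 1].

Definition Zn_adj (n : nat) : rel {ffun 'I_n -> int} :=
  [rel x y : {ffun 'I_n -> int} |
     [exists i, Z_adj (x i) (y i) &&
                [forall j, (j != i) ==> (x j == y j)]]].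

(* At an adjacent pair exactly one coordinate i differs, so the value there is
   I (x) ... (x) sigma_i (x_i) (y_i) (x) ... (x) I. *)
Definition product_connection (R : realType) (n : nat) (d : 'I_n -> nat)
    (sigma : forall i, int -> int -> 'M[R]_(d i))
    (x y : {ffun 'I_n -> int}) : 'M[R]_(kron_dim d) :=
  kron (fun j => if x j == y j then 1%:M else sigma j (x j) (y j)).

Definition unit_weight (R : realType) (V : Type) : V -> V -> R := fun _ _ => 1.

Definition simple_path (V : eqType) (adj : rel V) (x y : V) (p : seq V) : bool :=
  [&& path adj x p, uniq (x :: p) & last x p == y].

(* The vertices after x on the path x, x +- 1, ..., x + a. *)
Definition pathZ (x a : int) : seq int :=
  [seq x + sgz a * k%:Z | k <- iota 1 `|a|].

Lemma simple_pathZ_line (x : int) (p : seq int) :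
  path Z_adj x p -> uniq (x :: p) ->
  exists2 s : int, (s = 1 \/ s = -1) &
    p = [seq x + s * k%:Z | k <- iota 1 (size p)].
Proof.
elim: p x => [|y p IHp] x; first by exists 1; [left|].
rewrite [path _ _ _]/= => /andP[xy yp] /andP[xNp yp_uniq].
have [s' s'1 Ep] := IHp y yp yp_uniq.
have Ey : y = x + 1 \/ y = x - 1 by move: xy; rewrite /Z_adj /=; lia.
have {Ey} [s s1 Ey] : exists2 s : int, (s = 1 \/ s = -1) & y = x + s.
  by case: Ey => ->; [exists 1|exists (-1)]; auto.
exists s => //=; rewrite mulr1 -Ey; congr cons.
case: p => [//|z p] in xNp Ep {IHp yp yp_uniq} *.
have Es : s' = s.
  case: Ep => Ez _; move: xNp; rewrite !inE !negb_or => /and3P[_ xz _].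
  by move: xz Ez Ey; case: s'1 => ->; case: s1 => -> //; lia.
rewrite Ep size_map size_iota Es Ey (iotaDl 1 1) -map_comp.
by apply: eq_map => k /=; rewrite PoszD; ring.
Qed.

Lemma pathZ_simple (x a : int) : simple_path Z_adj x (x + a) (pathZ x a).
Proof.
have [s [s1 Ea]] : exists s : int, (s = 1 \/ s = -1) /\
    (a = s * `|a|%N /\ pathZ x a = [seq x + s * k%:Z | k <- iota 1 `|a|]).
  have [a0|a0|->] := ltgtP a 0.
  - by exists (-1); rewrite /pathZ ltr0_sgz //; split; [right|split; [lia|]].
  - by exists 1; rewrite /pathZ gtr0_sgz //; split; [left|split; [lia|]].
  - by exists 1; split; [left|].
case: Ea => Ea ->; rewrite {1}Ea; move: `|a|%N => m {a Ea}.
have Hp j : path Z_adj (x + s * j%:Z) [seq x + s * k%:Z | k <- iota j.+1 m].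
  elim: m j => //= m IHm j; rewrite IHm andbT /Z_adj /=.
  by case: s1 => ->; lia.
have inj : injective (fun k : nat => x + s * k%:Z).
  by move=> i j; case: s1 => ->; lia.
have E0 : x :: [seq x + s * k%:Z | k <- iota 1 m] =
    [seq x + s * k%:Z | k <- iota 0 m.+1] by rewrite /= mulr0 addr0.
apply/and3P; split.
- by have := Hp 0; rewrite mulr0 addr0.
- by rewrite E0 (map_inj_uniq inj) iota_uniq.
- case: m {Hp E0} => [|m]; first by rewrite /= mulr0 addr0.
  by rewrite -(addn1 m) iotaD map_cat last_cat /= add1n addn1.
Qed.

Lemma pathZ_unique (x a : int) (p : seq int) :
  simple_path Z_adj x (x + a) p -> p = pathZ x a.
Proof.
case/and3P=> xp up /eqP; have [s s1 Ep] := simple_pathZ_line xp up.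
have -> : last x p = x + s * (size p)%:Z.
  rewrite {1}Ep; case: (size p) => [|m]; first by rewrite /= mulr0 addr0.
  by rewrite -(addn1 m) iotaD map_cat last_cat /= add1n addn1.
move=> /addrI Ea; rewrite Ep /pathZ.
have -> : `|a|%N = size p by rewrite -Ea; case: s1 => ->; lia.
case: (size p) Ea => [//|m] Ea.
have -> // : sgz a = s.
by rewrite -Ea; case: s1 => ->; [rewrite gtr0_sgz|rewrite ltr0_sgz] => //; lia.
Qed.

Definition Zn_nbr (n : nat) (u : {ffun 'I_n -> int}) (p : 'I_n * bool) :
    {ffun 'I_n -> int} :=
  [ffun j => u j + (if j == p.1 then (-1) ^+ p.2 else 0)].

Lemma Zn_nbr_inj (n : nat) (u : {ffun 'I_n -> int}) : injective (Zn_nbr u).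
Proof.
move=> [i b] [k c] /ffunP E; have := E i; have := E k; rewrite !ffunE /= !eqxx.
rewrite [k == i]eq_sym; case: (eqVneq i k) => [->|_].
  by move=> _; case: b c {E} => -[] //=; lia.
by case: b {E} => /=; lia.
Qed.

Lemma Zn_adjP (n : nat) (u v : {ffun 'I_n -> int}) :
  reflect (exists p, Zn_nbr u p = v) (Zn_adj u v).
Proof.
apply: (iffP existsP) => [[i /andP[iuv /forallP uv]]|[[i b] <-]].
  exists (i, u i > v i); apply/ffunP => j; rewrite ffunE /=.
  have [->|ji] := eqVneq j i.
    by move: iuv; rewrite /Z_adj /=; case: ltP => /=; lia.
  by rewrite addr0; have := uv j; rewrite ji => /eqP.
exists i; rewrite /Z_adj /= ffunE /= eqxx; apply/andP; split.
  by case: b => /=; lia.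
by apply/forallP => j; apply/implyP => /negPf ji; rewrite ffunE /= ji addr0.
Qed.

Lemma Zn_nbr_sum (A : zmodType) (n : nat) (u : {ffun 'I_n -> int})
    (F : {ffun 'I_n -> int} -> A) :
  \sum_(v \in [set v | Zn_adj u v]) F v = \sum_p F (Zn_nbr u p).
Proof.
have -> : [set v | Zn_adj u v] = [set` map (Zn_nbr u) (enum {: 'I_n * bool})].
  apply/seteqP; split => v /=.
    by move=> /Zn_adjP[p <-]; apply: map_f; rewrite mem_enum.
  by move=> /mapP[p _ ->]; apply/Zn_adjP; exists p.
rewrite -fsbig_seq; first by rewrite big_map big_enum.
by rewrite map_inj_uniq ?enum_uniq //; apply: Zn_nbr_inj.
Qed.

Lemma connection_laplacian_Zn (R : realType) (n d : nat)
    (sigma : {ffun 'I_n -> int} -> {ffun 'I_n -> int} -> 'M[R]_d)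
    (f : {ffun 'I_n -> int} -> 'cV[R]_d) (u : {ffun 'I_n -> int}) :
  connection_laplacian (@Zn_adj n) (@unit_weight R _) sigma f u =
  f u - (2 * n)%:R^-1 *:
    \sum_(v \in [set v | Zn_adj u v]) (sigma u v *m f v).
Proof.
have deg v : wdegree (@Zn_adj n) (@unit_weight R _) v = (2 * n)%:R.
  by rewrite /wdegree Zn_nbr_sum sumr_const card_prod card_ord card_bool mulnC.
rewrite /connection_laplacian !Zn_nbr_sum scaler_sumr; congr (_ - _).
apply: eq_bigr => p _; rewrite !deg mulr1 -invfM -expr2 sqr_sqrtr //.
Qed.

(* Main.v *)
(** Parallel transport to the target vertex gauges the connection away: along an
edge it absorbs the connection matrix, so [(- t L)^k delta_y] is a scalar
sequence times the transport matrix.  That scalar sequence is the one of the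
trivial connection, generated by the commuting second differences
[s (2 - S_i - S_i^-1)] with [s = - t / 2n].  In one dimension
[(2 - z - z^-1)^k = (-1)^k z^-k (z - 1)^(2k)] yields the coefficients
[(-1)^m C(2k, k + m)], and in dimension [n] the exponential generating series is
the product of the one-dimensional ones, because both satisfy the same
recurrence by the Leibniz rule.  Absolute convergence lets one multiply the
sums. *)

Require Import Defs.
From mathcomp Require Import all_boot all_order all_algebra.
From mathcomp Require Import all_classical all_reals all_analysis.
From mathcomp Require Import mxtens zify ring.

Set Implicit Arguments.
Unset Strict Implicit.
Unset Printing Implicit Defensive.

Import Order.TTheory GRing.Theory Num.Theory.
Import numFieldNormedType.Exports.

Local Open Scope classical_set_scope.
Local Open Scope ring_scope.

(** * Cauchy products of absolutely convergent series *)

Definition cauchy_product (R : pzRingType) (a b : nat -> R) : nat -> R :=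
  fun k => \sum_(i < k.+1) a i * b (k - i)%N.

Definition cauchy_unit (R : pzRingType) : nat -> R := fun k => (k == 0%N)%:R.

(** Sum the triangle of pairs with [i + j < N] row by row; row [i] holds [N - i] terms. *)
Lemma series_cauchy_product (R : realType) (a b : nat -> R) (N : nat) :
  series (cauchy_product a b) N = \sum_(i < N) a i * series b (N - i)%N.
Proof.
elim: N => [|N IHN]; first by rewrite /series /= big_geq // big_ord0.
rewrite seriesSr IHN /cauchy_product !big_ord_recr /= addrA -big_split /=.
congr (_ + _); last by rewrite subnn subSnn seriesSr /series /= big_geq // add0r.
by apply: eq_bigr => i _; rewrite subSn 1?ltnW // seriesSr mulrDr.
Qed.

Lemma cauchy_product_ge0 (R : realType) (a b : nat -> R) :
  (forall k, 0 <= a k) -> (forall k, 0 <= b k) ->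
  forall k, 0 <= cauchy_product a b k.
Proof. by move=> a0 b0 k; apply: sumr_ge0 => i _; rewrite mulr_ge0. Qed.

Lemma nondecreasing_series_ge0 (R : realType) (a : nat -> R) :
  (forall k, 0 <= a k) -> {homo series a : m n / (m <= n)%N >-> m <= n}.
Proof. by move=> a0; apply: nondecreasing_series => k _ _. Qed.

Lemma mul_series_ord (R : realType) (a : nat -> R) (c : R) (N : nat) :
  series a N * c = \sum_(i < N) a i * c.
Proof. by rewrite /series /= big_mkord mulr_suml. Qed.

(** The triangle of side [N] lies in the square of side [N], itself inside the triangle of side
    [N + N]. For nonnegative terms this orders the partial sums, which bounds [C] and then
    identifies its limit by squeezing. *)
Lemma cvg_series_cauchy_product_ge0 (R : realType) (a b : nat -> R) :
  (forall k, 0 <= a k) -> (forall k, 0 <= b k) ->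
  cvgn (series a) -> cvgn (series b) ->
  series (cauchy_product a b) @ \oo --> limn (series a) * limn (series b).
Proof.
move=> a0 b0 ca cb; set C := series (cauchy_product a b).
have hA := nondecreasing_series_ge0 a0.
have hB := nondecreasing_series_ge0 b0.
have hC : {homo C : m n / (m <= n)%N >-> m <= n}.
  by apply: nondecreasing_series_ge0; exact: cauchy_product_ge0.
have A0 N : 0 <= series a N by rewrite /series /=; apply: sumr_ge0.
have B0 N : 0 <= series b N by rewrite /series /=; apply: sumr_ge0.
have C_le N : C N <= series a N * series b N.
  rewrite /C series_cauchy_product mul_series_ord; apply: ler_sum => i _.
  by rewrite ler_wpM2l // hB // leq_subr.
have le_C N : series a N * series b N <= C (N + N)%N.
  rewrite /C series_cauchy_product big_split_ord /= mul_series_ord.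
  rewrite -[leLHS]addr0; apply: lerD.
    by apply: ler_sum => i _; rewrite ler_wpM2l // hB //; have := ltn_ord i; lia.
  by apply: sumr_ge0 => i _; rewrite mulr_ge0.
have cC : cvgn C.
  apply: nondecreasing_is_cvgn => //.
  exists (limn (series a) * limn (series b)) => _ [N _ <-].
  by apply: (le_trans (C_le N)); rewrite ler_pM ?nondecreasing_cvgn_le.
suff cAB : (series a \* series b) @ \oo --> limn C.
  by rewrite -(cvg_unique _ cAB (cvgM ca cb)).
apply: (@squeeze_cvgr _ _ _ _ C (cst (limn C))); last exact: cvg_cst.
  near=> N; rewrite C_le /=; apply: le_trans (le_C N) _.
  exact: nondecreasing_cvgn_le.
exact: cC.
Unshelve. all: by end_near. Qed.

Lemma norm_cauchy_product_le (R : realType) (a b : nat -> R) (k : nat) :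
  `|cauchy_product a b k| <=
  cauchy_product (fun i => `|a i|) (fun i => `|b i|) k.
Proof.
rewrite /cauchy_product; apply: (le_trans (ler_norm_sum _ _ _)).
by apply: ler_sum => i _; rewrite normrM.
Qed.

Lemma norm_cauchy_product_cvg (R : realType) (a b : nat -> R) :
  cvgn [normed series a] -> cvgn [normed series b] ->
  cvgn [normed series (cauchy_product a b)].
Proof.
move=> ca cb; have ab := cvg_series_cauchy_product_ge0
  (fun k => normr_ge0 (a k)) (fun k => normr_ge0 (b k)) ca cb.
apply: series_le_cvg (cvgP _ ab) => k; first exact: normr_ge0.
- by apply: cauchy_product_ge0.
- exact: norm_cauchy_product_le.
Qed.

Lemma norm_series_diff_le (R : realType) (b : nat -> R) (m N : nat) :
  (m <= N)%N ->
  `|series b N - series b m| <= [normed series b] N - [normed series b] m.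
Proof.
move=> mN; rewrite !sub_series_geq //=; exact: ler_norm_sum.
Qed.

(* The error [A_N B_N - C_N] is dominated termwise by the corresponding error
   for the absolute values, which vanishes by the nonnegative case. *)
Lemma cvg_series_cauchy_product (R : realType) (a b : nat -> R) :
  cvgn [normed series a] -> cvgn [normed series b] ->
  series (cauchy_product a b) @ \oo --> limn (series a) * limn (series b).
Proof.
move=> na nb; have ca := normed_cvg na; have cb := normed_cvg nb.
pose a' k : R := `|a k|; pose b' k : R := `|b k|.
have cab' : series (cauchy_product a' b') @ \oo -->
    limn (series a') * limn (series b').
  by apply: cvg_series_cauchy_product_ge0 => // k; exact: normr_ge0.
have err N : `|series a N * series b N - series (cauchy_product a b) N| <=
    series a' N * series b' N - series (cauchy_product a' b') N.
  rewrite !series_cauchy_product !mul_series_ord -!sumrB.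
  apply: (le_trans (ler_norm_sum _ _ _)); apply: ler_sum => i _.
  rewrite -!mulrBr normrM ler_wpM2l //; apply: norm_series_diff_le.
  exact: leq_subr.
have e0 : (series a \* series b - series (cauchy_product a b)) @ \oo --> (0 : R).
  apply/norm_cvg0P; apply: (@squeeze_cvgr _ _ _ _ (cst 0)
    (series a' \* series b' - series (cauchy_product a' b'))).
  - by near=> N; rewrite normr_ge0 /=; exact: err.
  - exact: cvg_cst.
  - rewrite -[X in _ --> X](subrr (limn (series a') * limn (series b'))).
    exact: cvgB (cvgM na nb) cab'.
have <- : series a \* series b -
    (series a \* series b - series (cauchy_product a b)) =
    series (cauchy_product a b).
  by apply/funext => N; rewrite !fctE /= subKr.
rewrite -[X in _ --> X]subr0.
exact: cvgB (cvgM ca cb) e0.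
Unshelve. all: by end_near. Qed.

(** * Parallel transport as a gauge *)

Lemma signature_pathZ_step (R : realType) (d : nat)
    (sigma : int -> int -> 'M[R]_d) (x b e : int) :
  e = sgz b -> b != 0 ->
  signature sigma x (pathZ x b) =
  sigma x (x + e) *m signature sigma (x + e) (pathZ (x + e) (b - e)).
Proof.
move=> -> b0.
suff -> : pathZ x b = (x + sgz b) :: pathZ (x + sgz b) (b - sgz b) by [].
rewrite /pathZ; have [m Em] : exists m, `|b|%N = m.+1 by exists `|b|%N.-1; lia.
(* For [m = 0] the remaining displacement is zero and loses the sign of [b], but then no edge
   remains. *)
have Es : `|b - sgz b|%N = m /\ (m != 0%N -> sgz (b - sgz b) = sgz b).
  by case: (sgzP b) (sgzP (b - sgz b)) b0 Em => //=; lia.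
case: Es => -> Es; rewrite Em /= mulr1; congr cons.
case: m Es {Em} => [//|m] -> //.
rewrite (iotaDl 1 1) -map_comp; apply: eq_map => k /=.
by rewrite PoszD; ring.
Qed.

Lemma connection_mulKV (R : realType) (d : nat)
    (sigma : int -> int -> 'M[R]_d) (x y : int) :
  is_connection Z_adj sigma -> Z_adj x y -> sigma x y *m sigma y x = 1%:M.
Proof.
move=> sc xy; have [orth ->] := sc _ _ xy; apply: mulmxV.
by case: (mulmx1_unit orth).
Qed.

(* Stepping away from the target backtracks, and the backtracked edge cancels. *)
Lemma signature_pathZ_nbr (R : realType) (d : nat)
    (sigma : int -> int -> 'M[R]_d) (x b e : int) :
  is_connection Z_adj sigma -> `|e| = 1 ->
  sigma x (x + e) *m signature sigma (x + e) (pathZ (x + e) (b - e)) =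
  signature sigma x (pathZ x b).
Proof.
move=> sc e1; have [/andP[/eqP eb b0]|eb] := boolP ((e == sgz b) && (b != 0)).
  by rewrite -signature_pathZ_step.
(* This includes [b = 0], where every step leads away from the target. *)
have eNb : - e = sgz (b - e).
  by case: (sgzP b) (sgzP (b - e)) eb; lia.
rewrite (@signature_pathZ_step _ _ _ (x + e) (b - e) (- e)) //; last first.
  by move: eNb e1; case: sgzP; lia.
rewrite addrK opprK subrK mulmxA connection_mulKV ?mul1mx //.
by rewrite /Z_adj /=; lia.
Qed.

Lemma kron1 (R : realType) (n : nat) (d : 'I_n -> nat) :
  kron (fun i => 1%:M : 'M[R]_(d i)) = 1%:M.
Proof.
elim: n d => [//|n IHn] d /=; rewrite IHn; apply/matrixP => i j.
case: (mxtens_indexP i) => i0 i1; case: (mxtens_indexP j) => j0 j1.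
rewrite tensmxE !mxE -natrM mulnb (can_eq (@mxtens_indexK _ _)).
by rewrite xpair_eqE.
Qed.

Lemma kron_mul (R : realType) (n : nat) (d : 'I_n -> nat)
    (A B : forall i, 'M[R]_(d i)) :
  kron A *m kron B = kron (fun i => A i *m B i).
Proof.
elim: n d A B => [|n IHn] d A B /=; first by rewrite mul1mx.
by rewrite tensmx_mul IHn.
Qed.

(** The gauge: it acts on column vectors and carries the fibre over [y] to the fibre over [x], one
    coordinate path per tensor factor. *)
Definition product_transport (R : realType) (n : nat) (d : 'I_n -> nat)
    (sigma : forall i, int -> int -> 'M[R]_(d i))
    (x y : {ffun 'I_n -> int}) : 'M[R]_(kron_dim d) :=
  kron (fun i => signature (sigma i) (x i) (pathZ (x i) (y i - x i))).

Lemma product_transportxx (R : realType) (n : nat) (d : 'I_n -> nat)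
    (sigma : forall i, int -> int -> 'M[R]_(d i)) (y : {ffun 'I_n -> int}) :
  product_transport sigma y y = 1%:M.
Proof.
rewrite -[RHS]kron1; congr kron; apply: functional_extensionality_dep => i.
by rewrite subrr.
Qed.

(** The mixed-product rule reduces this to single factors: unmoved coordinates contribute an
    identity, and the moved one is the one-dimensional backtracking argument. *)
Lemma product_connection_transport (R : realType) (n : nat) (d : 'I_n -> nat)
    (sigma : forall i, int -> int -> 'M[R]_(d i))
    (u y : {ffun 'I_n -> int}) (p : 'I_n * bool) :
  (forall i, is_connection Z_adj (sigma i)) ->
  product_connection sigma u (Zn_nbr u p) *m
    product_transport sigma (Zn_nbr u p) y = product_transport sigma u y.
Proof.
move=> sc; rewrite kron_mul; congr kron; apply: functional_extensionality_dep => i.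
rewrite !ffunE; case: ifP => [/eqP|] Ei.
  by rewrite mul1mx -Ei.
case: (i == p.1) Ei => [_|]; last by rewrite addr0 eqxx.
by rewrite opprD addrA signature_pathZ_nbr //; case: p.2.
Qed.

(** * Scalar coefficients in one dimension *)

(** This is [s ^+ k / k!] times the coefficient of [z^m] in [(2 - z - z^-1)^k], which is even in
    [m]. *)
Definition lattice_coeff (R : realType) (s : R) (m : int) : nat -> R :=
  fun k => (-1) ^+ `|m|%N * ('C(2 * k, k + `|m|)%:R / k`!%:R * s ^+ k).

(** Pascal's rule twice, that is, multiplication of [(1 + z)^(2k)] by [(1 + z)^2]. *)
Lemma bin_lattice_rec (k m : nat) :
  'C(2 * k.+1, k.+1 + m.+1) =
  (2 * 'C(2 * k, k + m.+1) + 'C(2 * k, k + m) + 'C(2 * k, k + m.+2))%N.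
Proof.
rewrite mulnS (_ : k.+1 + m.+1 = (k + m).+2)%N; last by lia.
rewrite !addSn add0n !binS !addnS.
by move: 'C(_, _) 'C(_, _) 'C(_, _) => p q r; lia.
Qed.

(** At the centre the two outer neighbours coincide by the symmetry of binomials, which also avoids
    a truncated [k - 1]. *)
Lemma bin_lattice_rec0 (k : nat) :
  'C(2 * k.+1, k.+1) = (2 * 'C(2 * k, k) + 2 * 'C(2 * k, k.+1))%N.
Proof.
case: k => [//|k]; have sym : 'C(2 * k.+1, k) = 'C(2 * k.+1, k.+2).
  by rewrite -bin_sub; [congr 'C(_, _); lia|lia].
rewrite [(2 * k.+2)%N]mulnS; move: (2 * k.+1)%N sym => N sym.
rewrite !addSn add0n !binS sym.
by move: 'C(_, _) 'C(_, _) => p q; lia.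
Qed.

(** One more factor [2 - z - z^-1]; the factor [k.+1] absorbs the growth of the factorial, and the
    alternating sign turns the plus signs of Pascal's rule into minus signs. *)
Lemma lattice_coeff_rec (R : realType) (s : R) (m : int) (k : nat) :
  k.+1%:R * lattice_coeff s m k.+1 =
  s * (2 * lattice_coeff s m k - \sum_b lattice_coeff s (m + (-1) ^+ (b : bool)) k).
Proof.
have E (c : R) : k.+1%:R * (c / k.+1`!%:R * s ^+ k.+1) = s * (c / k`!%:R * s ^+ k).
  have f0 : k`!%:R != 0 :> R by rewrite pnatr_eq0 -lt0n fact_gt0.
  have k0 : k.+1%:R != 0 :> R by rewrite pnatr_eq0.
  rewrite factS natrM exprS; move: (k.+1%:R) k0 => z z0.
  by field; rewrite f0 z0.
rewrite /lattice_coeff mulrCA E big_bool /= expr1 expr0.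
(* The reflection [m -> - m] merely swaps the two neighbours. *)
wlog m0 : m / 0 <= m.
  move=> W; have [/W//|m0] := leP 0 m.
  have := W (- m); rewrite abszN.
  have -> : `|(- m - 1)%R|%N = `|(m + 1)%R|%N by lia.
  have -> : `|(- m + 1)%R|%N = `|(m - 1)%R|%N by lia.
  by move=> ->; [rewrite [X in _ - X]addrC|lia].
case: m m0 => [[|m]|] // _.
  by rewrite /= subnn !addn1 !addn0 bin_lattice_rec0 natrD !natrM expr0 expr1; ring.
have -> : `|(m.+1%:Z - 1)%R|%N = m by lia.
have -> : `|(m.+1%:Z + 1)%R|%N = m.+2 by lia.
by rewrite /= bin_lattice_rec 2!natrD natrM !exprS; ring.
Qed.

Lemma lattice_coeff0 (R : realType) (s : R) (m : int) :
  lattice_coeff s m 0 = (m == 0)%:R.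
Proof.
rewrite /lattice_coeff muln0 bin0n add0n fact0 expr0 divr1 mulr1.
case: (eqVneq m 0) => [->|m0]; first by rewrite mulr1.
by rewrite (_ : (`|m| == 0)%N = false) ?mulr0 //; apply/eqP; lia.
Qed.

Lemma bin_le_expn2 (n m : nat) : ('C(n, m) <= 2 ^ n)%N.
Proof.
have [mn|nm] := leqP m n; last by rewrite bin_small.
rewrite -[2%N]/(1 + 1)%N expnDn (bigD1 (Ordinal (mn : (m < n.+1)%N))) //=.
by rewrite !exp1n !muln1 leq_addr.
Qed.

(** Binomials of [2 * k] are at most [4 ^ k], so the exponential series at [4 * |s|] dominates. *)
Lemma normed_lattice_coeff_cvg (R : realType) (s : R) (m : int) :
  cvgn [normed series (lattice_coeff s m)].
Proof.
apply: series_le_cvg (is_cvg_series_exp_coeff (4 * `|s|)) => k; first exact: normr_ge0.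
  by rewrite /exp_coeff /=; rewrite divr_ge0 // exprn_ge0 // mulr_ge0.
rewrite /exp_coeff /= /lattice_coeff normrM normrX normrN1 expr1n mul1r.
rewrite normrM normrX exprMn ger0_norm; last by rewrite divr_ge0.
rewrite [leLHS]mulrAC; apply: ler_wpM2r; first by rewrite invr_ge0.
apply: ler_wpM2r; first exact: exprn_ge0.
by rewrite -natrX ler_nat (_ : 4 = 2 ^ 2)%N // -expnM bin_le_expn2.
Qed.

(** * Leibniz rule and coefficients in dimension [n] *)

Lemma cauchy_productr_sum (R : pzRingType) (I : finType) (a : nat -> R)
    (b : I -> nat -> R) (k : nat) :
  cauchy_product a (fun l => \sum_i b i l) k =
  \sum_i cauchy_product a (b i) k.
Proof.
rewrite /cauchy_product exchange_big; apply: eq_bigr => j _.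
by rewrite mulr_sumr.
Qed.

Lemma cauchy_productl_sum (R : pzRingType) (I : finType) (a : I -> nat -> R)
    (b : nat -> R) (k : nat) :
  cauchy_product (fun l => \sum_i a i l) b k =
  \sum_i cauchy_product (a i) b k.
Proof.
rewrite /cauchy_product exchange_big; apply: eq_bigr => j _.
by rewrite mulr_suml.
Qed.

(** The product rule for derivatives of generating series: split [k.+1] as [i + (k.+1 - i)]; the
    boundary term with zero weight drops out of each sum. *)
Lemma cauchy_product_leibniz (R : comPzRingType) (a b : nat -> R) (k : nat) :
  k.+1%:R * cauchy_product a b k.+1 =
  cauchy_product (fun l => l.+1%:R * a l.+1) b k +
  cauchy_product a (fun l => l.+1%:R * b l.+1) k.
Proof.
have -> : k.+1%:R * cauchy_product a b k.+1 =
    \sum_(i < k.+2) (i%:R * a i * b (k.+1 - i)%N) +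
    \sum_(i < k.+2) (a i * ((k.+1 - i)%:R * b (k.+1 - i)%N)).
  rewrite /cauchy_product -big_split mulr_sumr /=; apply: eq_bigr => i _.
  have {1}-> : k.+1 = (i + (k.+1 - i))%N by rewrite subnKC // -ltnS.
  by rewrite natrD; ring.
congr (_ + _).
  by rewrite big_ord_recl !mul0r add0r; apply: eq_bigr.
rewrite big_ord_recr /= subnn mul0r mulr0 addr0; apply: eq_bigr => i _.
by rewrite subSn // -ltnS.
Qed.

(** Equivalently, [s ^+ k / k!] times the coefficient of the monomial with exponents [m i] in the
    [k]-th power of the sum over [i] of [2 - z_i - z_i^-1]. *)
Definition lattice_product_coeff (R : realType) (s : R) (n : nat)
    (m : 'I_n -> int) : nat -> R :=
  \big[@cauchy_product R/@cauchy_unit R]_(i < n) lattice_coeff s (m i).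

Lemma lattice_product_coeff_recl (R : realType) (s : R) (n : nat)
    (m : 'I_n.+1 -> int) :
  lattice_product_coeff s m =
  cauchy_product (lattice_coeff s (m ord0))
    (lattice_product_coeff s (fun i => m (lift ord0 i))).
Proof. by rewrite /lattice_product_coeff big_ord_recl. Qed.

Definition lattice_step (n : nat) (m : 'I_n -> int) (i : 'I_n) (e : int) :
    'I_n -> int :=
  fun j => m j + (if j == i then e else 0).

(** Induction on the dimension: in the Leibniz rule, differentiating the first factor moves
    coordinate [ord0], and differentiating the rest moves the others by the induction hypothesis. *)
Lemma lattice_product_coeff_rec (R : realType) (s : R) (n : nat)
    (m : 'I_n -> int) (k : nat) :
  k.+1%:R * lattice_product_coeff s m k.+1 =
  \sum_(i < n) s * (2 * lattice_product_coeff s m k -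
    \sum_b lattice_product_coeff s (lattice_step m i ((-1) ^+ (b : bool))) k).
Proof.
elim: n m k => [|n IHn] m k.
  by rewrite /lattice_product_coeff !big_ord0 /cauchy_unit mulr0.
rewrite lattice_product_coeff_recl cauchy_product_leibniz big_ord_recl.
set G := lattice_product_coeff s (fun i => m (lift ord0 i)).
congr (_ + _).
  rewrite (_ : (fun l => _) = fun l => s * (2 * lattice_coeff s (m ord0) l -
      \sum_b lattice_coeff s (m ord0 + (-1) ^+ (b : bool)) l)); last first.
    by apply/funext => l; exact: lattice_coeff_rec.
  transitivity (s * (2 * cauchy_product (lattice_coeff s (m ord0)) G k -
    \sum_b cauchy_product (lattice_coeff s (m ord0 + (-1) ^+ (b : bool))) G k)).
    rewrite -cauchy_productl_sum /cauchy_product !mulr_sumr -sumrB mulr_sumr.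
    by apply: eq_bigr => i _; ring.
  congr (_ * (_ - _)); apply: eq_bigr => b _.
  rewrite lattice_product_coeff_recl /lattice_step eqxx; congr cauchy_product.
  by congr lattice_product_coeff; apply/funext => j; rewrite addr0.
rewrite (_ : (fun l => _) = fun l => \sum_(i < n) s * (2 * G l -
    \sum_b lattice_product_coeff s
      (lattice_step (fun i => m (lift ord0 i)) i ((-1) ^+ (b : bool))) l));
  last by apply/funext => l; exact: IHn.
rewrite cauchy_productr_sum; apply: eq_bigr => i _.
set g := fun b : bool => lattice_product_coeff s
  (lattice_step (fun i => m (lift ord0 i)) i ((-1) ^+ b)).
transitivity (s * (2 * cauchy_product (lattice_coeff s (m ord0)) G k -
    \sum_b cauchy_product (lattice_coeff s (m ord0)) (g b) k)).
  rewrite -cauchy_productr_sum /cauchy_product !mulr_sumr -sumrB mulr_sumr.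
  by apply: eq_bigr => j _; ring.
congr (_ * (_ - _)); apply: eq_bigr => b _.
by rewrite lattice_product_coeff_recl /lattice_step /= addr0; congr cauchy_product.
Qed.

Lemma lattice_product_coeff0 (R : realType) (s : R) (n : nat)
    (m : 'I_n -> int) :
  lattice_product_coeff s m 0 = [forall i, m i == 0]%:R.
Proof.
have -> : lattice_product_coeff s m 0 = \prod_(i < n) (m i == 0)%:R.
  elim: n m => [|n IHn] m; first by rewrite /lattice_product_coeff !big_ord0.
  rewrite lattice_product_coeff_recl /cauchy_product big_ord1 big_ord_recl.
  by rewrite lattice_coeff0 IHn.
case: (boolP [forall i, m i == 0]) => [/forallP m0|].
  by apply: big1 => i _; rewrite m0.
rewrite negb_forall => /existsP[i /negPf mi].
by rewrite (bigD1 i) //= mi mul0r.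
Qed.

Lemma normed_lattice_product_coeff_cvg (R : realType) (s : R) (n : nat)
    (m : 'I_n -> int) :
  cvgn [normed series (lattice_product_coeff s m)].
Proof.
elim: n m => [|n IHn] m; last first.
  rewrite lattice_product_coeff_recl; apply: norm_cauchy_product_cvg => //.
  exact: normed_lattice_coeff_cvg.
(* In dimension zero the sequence is [1, 0, 0, ...], dominated by the exponential series at 1. *)
apply: series_le_cvg (is_cvg_series_exp_coeff 1) => k; first exact: normr_ge0.
  by rewrite exp_coeff_ge0.
rewrite /= /lattice_product_coeff big_ord0 /cauchy_unit ger0_norm //.
by rewrite /exp_coeff /= expr1n mul1r; case: k => [|k]; rewrite ?fact0 ?invr1 ?invr_ge0.
Qed.

Lemma cvg_series_cauchy_unit (R : realType) :
  series (@cauchy_unit R) @ \oo --> (1 : R).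
Proof.
apply: cvg_near_cst; exists 1%N => // -[//|N] _.
by rewrite /series /= big_nat_recl //= big1 ?addr0.
Qed.

Lemma cvg_series_lattice_product_coeff (R : realType) (s : R) (n : nat)
    (m : 'I_n -> int) :
  series (lattice_product_coeff s m) @ \oo -->
  \prod_(i < n) limn (series (lattice_coeff s (m i))).
Proof.
elim: n m => [|n IHn] m.
  rewrite big_ord0 /lattice_product_coeff big_ord0.
  exact: cvg_series_cauchy_unit.
rewrite lattice_product_coeff_recl big_ord_recl.
rewrite -(cvg_lim _ (IHn (fun i => m (lift ord0 i)))) //.
apply: cvg_series_cauchy_product; first exact: normed_lattice_coeff_cvg.
exact: normed_lattice_product_coeff_cvg.
Qed.

(** * Powers of the generator and the heat kernel *)

(** The transport factors out of each application of the generator, leaving the scalar recurrence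
    and the initial value already established for [lattice_product_coeff]. *)
Lemma iter_heat_generator (R : realType) (n : nat) (d : 'I_n -> nat)
    (sigma : forall i, int -> int -> 'M[R]_(d i)) (t : R)
    (y u : {ffun 'I_n -> int}) (j : 'I_(kron_dim d)) (k : nat) :
  (0 < n)%N -> (forall i, is_connection Z_adj (sigma i)) ->
  (k`!%:R)^-1 *: iter k (heat_generator (@Zn_adj n) (@unit_weight R _)
    (product_connection sigma) t) (delta_fun R y j) u =
  lattice_product_coeff (- (t / (2 * n)%:R)) (fun i => y i - u i) k *:
    (product_transport sigma u y *m delta_mx j 0).
Proof.
move=> n0 sc; set s := - (t / _); elim: k u => [|k IHk] u.
  rewrite lattice_product_coeff0 fact0 invr1 scale1r /= /delta_fun.
  have -> : [forall i, y i - u i == 0] = (u == y).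
    apply/forallP/eqP => [yu|-> i]; last by rewrite subrr.
    by apply/ffunP => i; apply/esym/eqP; rewrite -subr_eq0.
  case: eqP => [->|_]; last by rewrite scale0r.
  by rewrite product_transportxx mul1mx scale1r.
have k0 : k.+1%:R != 0 :> R by rewrite pnatr_eq0.
set v := _ *m _; pose F w := lattice_product_coeff s (fun i => y i - w i) k.
rewrite iterS; set f := iter k _ _ in IHk *.
have {}IHk w : f w = (k`!%:R * F w) *: (product_transport sigma w y *m delta_mx j 0).
  by rewrite -scalerA -IHk scalerA mulfV ?scale1r // pnatr_eq0 -lt0n fact_gt0.
rewrite /heat_generator connection_laplacian_Zn Zn_nbr_sum.
(* By gauge invariance every neighbour contributes a multiple of the same vector [v], so only
   scalars remain to be compared. *)
have -> : \sum_p product_connection sigma u (Zn_nbr u p) *m f (Zn_nbr u p) =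
    (k`!%:R * \sum_p F (Zn_nbr u p)) *: v.
  rewrite mulr_sumr scaler_suml; apply: eq_bigr => p _.
  by rewrite IHk -scalemxAr mulmxA product_connection_transport.
rewrite IHk -/v !scalerA -scalerBl scalerA; congr (_ *: _).
apply: (mulfI k0); rewrite lattice_product_coeff_rec -/(F u).
have -> : \sum_p F (Zn_nbr u p) = \sum_(i < n) \sum_b lattice_product_coeff s
    (lattice_step (fun i => y i - u i) i ((-1) ^+ (b : bool))) k.
  (* Moving [u] by a unit moves [y - u] by the opposite unit, hence the flip of the sign bit. *)
  rewrite -(pair_big xpredT xpredT (fun i b => F (Zn_nbr u (i, b)))) /=.
  apply: eq_bigr => i _; rewrite (reindex_inj negb_inj) /=.
  apply: eq_bigr => b _; congr (lattice_product_coeff s _ k); apply/funext => l.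
  rewrite /lattice_step ffunE /= opprD addrA; congr (_ + _).
  by case: ifP => _; rewrite ?oppr0 //; case: b.
(* The [n] diagonal terms add up to [2 n s = - t], the diagonal part of the generator; this uses
   [n != 0]. *)
rewrite -mulr_sumr sumrB sumr_const card_ord factS natrM invfM.
rewrite -[_ *+ n]mulr_natr /s; set S := \sum_i _.
have f0 : k`!%:R != 0 :> R by rewrite pnatr_eq0 -lt0n fact_gt0.
have nR : n%:R != 0 :> R by rewrite pnatr_eq0 -lt0n.
rewrite !natrM; move: (k.+1%:R) k0 (k`!%:R) f0 n%:R nR => z z0 w w0 r r0.
by field; rewrite z0 w0 r0.
Qed.

Theorem theorem4 (R : realType) (n : nat) (n_gt0 : (0 < n)%N)
    (d : 'I_n -> nat) (sigma : forall i : 'I_n, int -> int -> 'M[R]_(d i))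
    (sigma_conn : forall i : 'I_n, is_connection Z_adj (sigma i))
    (t : R) (x a : {ffun 'I_n -> int}) :
  let sigmah := product_connection sigma in
  let w := @unit_weight R {ffun 'I_n -> int} in
  let coeff (i : 'I_n) : nat -> R := fun k =>
    'C(2 * k, k + `|a i|)%:R / k`!%:R * (- (t / (2 * n)%:R)) ^+ k in
  [/\ forall j, cvgn (op_exp_series (heat_generator (@Zn_adj n) w sigmah t)
                        (delta_fun R (x + a) j) x),
      forall i, cvgn (series (coeff i)) &
      heat_kernel (@Zn_adj n) w sigmah t x (x + a) =
        (\prod_(i < n) ((-1) ^+ `|a i|%N * limn (series (coeff i))))
          *: kron (fun i => signature (sigma i) (x i) (pathZ (x i) (a i)))].
Proof.
move=> sigmah w coeff; set s := - (t / (2 * n)%:R).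
have coeffE i : lattice_coeff s (a i) = (-1) ^+ `|a i|%N *: coeff i by [].
have coeff_cvg i : cvgn (series (coeff i)).
  have -> : coeff i = (-1) ^+ `|a i|%N *: lattice_coeff s (a i).
    by rewrite coeffE scalerA -expr2 sqrr_sign scale1r.
  apply: is_cvg_seriesZ; apply: normed_cvg.
  exact: normed_lattice_coeff_cvg.
have diffE : (fun i => (x + a) i - x i) = a.
  by apply/funext => i; rewrite !ffunE addrC addKr.
pose K := kron (fun i => signature (sigma i) (x i) (pathZ (x i) (a i))).
have transportE : product_transport sigma x (x + a) = K.
  congr kron; apply: functional_extensionality_dep => i.
  by rewrite -[(x + a) i - x i]/((fun i => (x + a) i - x i) i) diffE.
set c := \prod_(i < n) _.
(* The exponential series at [x] is a scalar series times the fixed vector [K *m delta_mx j 0], the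
   [j]-th column of [K]. *)
have exp_cvg j : op_exp_series (heat_generator (@Zn_adj n) w sigmah t)
    (delta_fun R (x + a) j) x @ \oo --> c *: (K *m delta_mx j 0).
  rewrite (_ : op_exp_series _ _ _ =
      fun N => series (lattice_product_coeff s a) N *: (K *m delta_mx j 0)).
    apply: cvgZr_tmp; rewrite [c](_ : _ =
      \prod_(i < n) limn (series (lattice_coeff s (a i)))).
      exact: cvg_series_lattice_product_coeff.
    by apply: eq_bigr => i _; rewrite coeffE lim_seriesZ.
  apply/funext => N; rewrite /op_exp_series /series /= scaler_suml.
  by apply: eq_bigr => k _; rewrite iter_heat_generator // diffE transportE.
split=> // [j|]; first exact: cvgP (exp_cvg j).
apply/matrixP => i j; rewrite mxE /op_exp (cvg_lim _ (exp_cvg j)) //.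
by rewrite -colE !mxE.
Qed.
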